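(* Let $(M,g)$ be a Riemannian manifold, let $r>0$, and let $F:T_1M\to T_rM$ be the map $F(p,\mathtt{u})=(p,r\mathtt{u})$. Let $\varphi_A$ and $\varphi_r$ be the structure tensors of type $(1,1)$ of the almost contact structures on $T_1M$ and $T_rM$ described in the context, and write $a$ for the positive constant $a(\frac12)$. Then $F$ is a $(\varphi_A,\varphi_r)$-map between almost contact manifolds, i.e. $dF\circ\varphi_A=\varphi_r\circ dF$, if and only if $r=\sqrt a$.
   Context: For $r>0$, $T_rM=\{v\in T(M): g(v,v)=r^2\}$. Structure on $T_rM$: in local coordinates $(x^i,v^i)$ on $T(M)$, the vector fields $\delta_i=\frac{\partial}{\partial x^i}-\Gamma_{ij}^kv^j\frac{\partial}{\partial v^k}$ and $Z_i=\frac{\partial}{\partial v^i}-\frac1{r^2}g_{i\star}v^k\frac{\partial}{\partial v^k}$, with $g_{i\star}=g_{ij}v^j$, span the tangent spaces of $T_rM$. $T(M)$ carries the Sasaki metric $g_S$ and the almost complex structure $J_SX^H=X^V$, $J_SX^V=-X^H$; $\varphi_rU$ is the tangential part of $J_SU$, so $$\varphi_r\delta_i=Z_i,\qquad \varphi_rZ_i=-\left(\delta_i^h-\tfrac1{r^2}g_{i\star}v^h\right)\delta_h.$$ Structure on $T_1M$: let $a,b:[0,+\infty)\to[0,+\infty)$ be smooth with $a>0$, $\epsilon=\pm1$, $t=\frac12g(\mathtt{u},\mathtt{u})$. $T(M)\setminus 0$ carries the metric $g_A(X^H,Y^H)=g(X,Y)$, $g_A(X^H,Y^V)=0$, $g_A(X^V,Y^V)=a(t)g(X,Y)+b(t)g(X,\mathtt{u})g(Y,\mathtt{u})$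 and the compatible almost complex structure $$J_AX^H=\frac1{\sqrt{a}}X^V-\frac1{2t}\left(\frac1{\sqrt{a}}+\frac{\epsilon}{\sqrt{a+2bt}}\right)g(X,\mathtt{u})\mathtt{u}^V,\quad J_AX^V=-\sqrt{a}X^H+\frac1{2t}\left(\sqrt{a}+\epsilon\sqrt{a+2bt}\right)g(X,\mathtt{u})\mathtt{u}^H.$$ $\varphi_AU$ is the tangential part of $J_AU$ for $U$ tangent to $T_1M$. In local coordinates $(x^i,y^i)$, with $\delta_i=\frac{\partial}{\partial x^i}-\Gamma_{ij}^ky^j\frac{\partial}{\partial y^k}$, $g_{i0}=g_{ij}y^j$ and $Y_i=\frac{\partial}{\partial y^i}-g_{i0}y^h\frac{\partial}{\partial y^h}$ spanning the tangent spaces of $T_1M$, $$\varphi_A\delta_i=\tfrac1{\sqrt a}Y_i,\qquad \varphi_AY_i=-\sqrt a\left(\delta_i^h-g_{i0}y^h\right)\delta_h,\qquad a=a(\tfrac12).$$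
   Formalization: The manifold M is additionally assumed nonempty and of dimension at least 2; in dimension 1 both structure tensors vanish, and for empty M the condition is vacuous, so F is a (φ_A, φ_r)-map for every r > 0 and the stated equivalence fails. *)

(* Defs.v *)
From HB Require Import structures.
From mathcomp Require Import all_boot all_order all_algebra.
From mathcomp Require Import all_classical all_reals all_analysis.
Import Order.TTheory GRing.Theory Num.Theory.
Import numFieldNormedType.Exports.

Set Implicit Arguments.
Unset Strict Implicit.
Unset Printing Implicit Defensive.

Local Open Scope classical_set_scope.
Local Open Scope ring_scope.

(* C^k and C^oo maps on a subset of a (finite-dimensional) normed space; the
   set is meant to be open, differentials being taken in the whole space. *)
Fixpoint Ck (R : realType) (V W : normedModType R) (A : set V) (k : nat)
    (f : V -> W) : Prop :=
  if k is k'.+1 then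
    (forall x, A x -> differentiable f x) /\
    (forall v, Ck A k' (fun x => 'd f x v))
  else forall x, A x -> {for x, continuous f}.

Definition smooth_on (R : realType) (V W : normedModType R) (A : set V)
  (f : V -> W) : Prop := forall k, Ck A k f.

(* Smoothness on the closed half-line: restriction of a smooth function on R. *)
Definition smooth_halfline (R : realType) (f : R -> R) : Prop :=
  exists2 h : R -> R, smooth_on setT h & forall t, 0 <= t -> f t = h t.

(* The atlas need not be maximal.  [chart_param i] is the inverse of the chart
   [chart_coord i]; its values outside the image of the chart are irrelevant. *)
Record smooth_manifold (R : realType) (n : nat) : Type := SmoothManifold {
  manifold_space :> topologicalType ;
  manifold_hausdorff : hausdorff_space manifold_space ;
  manifold_countable : @second_countable manifold_space ;
  chart : Type ;
  chart_dom : chart -> set manifold_space ;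
  chart_coord : chart -> manifold_space -> 'rV[R]_n ;
  chart_param : chart -> 'rV[R]_n -> manifold_space ;
  chart_dom_cover : forall p, exists i, chart_dom i p ;
  chart_dom_open : forall i, open (chart_dom i) ;
  chart_image_open : forall i, open (chart_coord i @` chart_dom i) ;
  chart_coordK : forall i p,
    chart_dom i p -> chart_param i (chart_coord i p) = p ;
  chart_coord_continuous : forall i p,
    chart_dom i p -> {for p, continuous (chart_coord i)} ;
  chart_param_continuous : forall i x,
    (chart_coord i @` chart_dom i) x -> {for x, continuous (chart_param i)} ;
  transition_smooth : forall i j,
    smooth_on (chart_coord i @` (chart_dom i `&` chart_dom j))
              (chart_coord j \o chart_param i) }.

Section TangentSpace.
Context {R : realType} {n : nat} (M : smooth_manifold R n).
Implicit Types (p : M) (i j : chart M).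

Definition transition i j p (y : 'rV[R]_n) : 'rV[R]_n :=
  'd (chart_coord j \o chart_param i) (chart_coord i p) y.

(* A tangent vector at p is a family of components, one row vector for each
   chart at p, related by the Jacobians of the transition maps; the entries at
   the charts whose domain does not contain p are set to 0. *)
Definition is_tangent p (v : chart M -> 'rV[R]_n) : Prop :=
  (forall i j, chart_dom i p -> chart_dom j p ->
     v j = transition i j p (v i)) /\
  (forall i, ~ chart_dom i p -> v i = 0).

Definition tangent_pred p : {pred chart M -> 'rV[R]_n} :=
  fun v => `[< is_tangent p v >].

Fact tangent_submod_closed p : submod_closed (tangent_pred p).
Proof.
split=> [|a u v /asboolP[u1 u2] /asboolP[v1 v2]]; apply/asboolP; split.
- by move=> i j _ _; rewrite /transition linear0.
- by [].
- move=> i j pi pj; rewrite /transition linearP.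
  by congr (_ *: _ + _); [exact: u1|exact: v1].
- move=> i pi; rewrite -[LHS]/(a *: u i + v i).
  by rewrite u2// v2// scaler0 addr0.
Qed.

HB.instance Definition _ p :=
  GRing.isSubmodClosed.Build R _ (tangent_pred p) (tangent_submod_closed p).

Record tangent p := Tangent {
  component : chart M -> 'rV[R]_n ;
  componentP : component \in tangent_pred p }.

Set Warnings "-redundant-canonical-projection".
HB.instance Definition _ p := [isSub for @component p].
HB.instance Definition _ p := [Choice of tangent p by <:].
HB.instance Definition _ p := [SubChoice_isSubLmodule of tangent p by <:].

Lemma transition_comp i j k p (y : 'rV[R]_n) :
  chart_dom i p -> chart_dom j p -> chart_dom k p ->
  transition i k p y = transition j k p (transition i j p y).
Proof.
move=> pi pj pk; rewrite /transition.
have dij : differentiable (chart_coord j \o chart_param i) (chart_coord i p).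
  by apply: (transition_smooth i j 1).1; exists p.
have djk : differentiable (chart_coord k \o chart_param j) (chart_coord j p).
  by apply: (transition_smooth j k 1).1; exists p.
have dik : differentiable (chart_coord k \o chart_param i) (chart_coord i p).
  by apply: (transition_smooth i k 1).1; exists p.
have E : (chart_coord j \o chart_param i) (chart_coord i p) = chart_coord j p.
  by rewrite /= chart_coordK.
have djk' : differentiable (chart_coord k \o chart_param j)
    ((chart_coord j \o chart_param i) (chart_coord i p)) by rewrite E.
have near_dom : \forall x \near chart_coord i p, chart_dom j (chart_param i x).
  apply: chart_param_continuous; first by exists p.
  by apply: open_nbhs_nbhs; split; [exact: chart_dom_open|rewrite chart_coordK].
have d := diff_comp dij djk'.
have E1 : 'D_y (chart_coord k \o chart_param i) (chart_coord i p) =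
          'D_y ((chart_coord k \o chart_param j) \o
                (chart_coord j \o chart_param i))
              (chart_coord i p).
  apply: near_eq_derive.
  by near=> x => /=; rewrite (@chart_coordK _ _ _ j)//; near: x.
apply: (etrans (esym (deriveE y dik))); apply: (etrans E1).
apply: (etrans (deriveE y (differentiable_comp dij djk'))).
apply: (etrans (congr1 (fun h => h y) d)).
by rewrite -E.
Unshelve. all: by end_near. Qed.

(* The tangent vector at p whose components in the chart i are y. *)
Definition tvec_fun i p (y : 'rV[R]_n) : chart M -> 'rV[R]_n :=
  fun j => if `[< chart_dom i p /\ chart_dom j p >]
           then transition i j p y else 0.

Fact tvec_subproof i p y : tvec_fun i p y \in tangent_pred p.
Proof.
apply/asboolP; split=> [j k pj pk|j pj]; rewrite /tvec_fun; last first.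
  by case: asboolP => // -[].
case: (pselect (chart_dom i p)) => pi.
  by rewrite !asboolT//; exact: transition_comp.
by rewrite !asboolF ?[in RHS]/transition ?linear0// => -[].
Qed.

Definition tvec i p (y : 'rV[R]_n) : tangent p := Tangent (tvec_subproof i p y).

End TangentSpace.

Record riemannian_metric (R : realType) (n : nat) (M : smooth_manifold R n) :=
  RiemannianMetric {
  metric : forall p : M, tangent p -> tangent p -> R ;
  metric_sym : forall p (X Y : tangent p), metric X Y = metric Y X ;
  metric_linear : forall p (k : R) (X Y Z : tangent p),
    metric (k *: X + Y) Z = k * metric X Z + metric Y Z ;
  metric_pos : forall p (X : tangent p), X != 0 -> 0 < metric X X ;
  metric_smooth : forall (c : chart M) (i j : 'I_n),
    smooth_on (chart_coord c @` chart_dom c)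
      (fun x : 'rV[R]_n => metric (tvec c (chart_param c x) (delta_mx 0 i))
                                  (tvec c (chart_param c x) (delta_mx 0 j))) }.

(* Points of T(M) are pairs (p, u).  A chart c of M induces on T(M) the
   coordinates (x, v); vectors tangent to T(M) at a point over the domain of c
   are written in these coordinates, as pairs in 'rV_n * 'rV_n. *)
Section TangentBundle.
Context {R : realType} {n : nat} {M : smooth_manifold R n}.
Variable g : riemannian_metric M.
Implicit Types (c : chart M) (x : 'rV[R]_n) (i j k l : 'I_n).

Definition TM : Type := {p : M & tangent p}.
Definition tm_base (q : TM) : M := projT1 q.
Definition tm_vect (q : TM) : tangent (tm_base q) := projT2 q.

Definition TTM : normedModType R := ('rV[R]_n * 'rV[R]_n)%type.

Definition tcoord c (q : TM) : TTM :=
  (chart_coord c (tm_base q), component (tm_vect q) c).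
Definition tparam c (z : TTM) : TM :=
  existT _ (chart_param c z.1) (tvec c (chart_param c z.1) z.2).

Definition gcoef c i j x : R :=
  metric g (tvec c (chart_param c x) (delta_mx 0 i))
           (tvec c (chart_param c x) (delta_mx 0 j)).

Definition gmx c x : 'M[R]_n := \matrix_(i, j) gcoef c i j x.

(* Gamma_{ij}^k, for the Levi-Civita connection *)
Definition christoffel c x i j k : R :=
  2^-1 * \sum_l invmx (gmx c x) k l *
    ('D_(delta_mx 0 i) (gcoef c j l) x + 'D_(delta_mx 0 j) (gcoef c i l) x
     - 'D_(delta_mx 0 l) (gcoef c i j) x).

(* The row vector (Gamma_{ij}^k X^i u^j)_k, u being the vector part of q *)
Definition christoffel_form c (q : TM) (X : 'rV[R]_n) : 'rV[R]_n :=
  \row_k \sum_i \sum_j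
    christoffel c (chart_coord c (tm_base q)) i j k * X 0 i
    * component (tm_vect q) c 0 j.

Definition vlift c (q : TM) (X : tangent (tm_base q)) : TTM :=
  (0, component X c).
Definition hlift c (q : TM) (X : tangent (tm_base q)) : TTM :=
  (component X c, - christoffel_form c q (component X c)).

(* U = hlift (hpart U) + vlift (vpart U) *)
Definition hpart c (q : TM) (U : TTM) : tangent (tm_base q) :=
  tvec c (tm_base q) U.1.
Definition vpart c (q : TM) (U : TTM) : tangent (tm_base q) :=
  tvec c (tm_base q) (U.2 + christoffel_form c q U.1).

Definition energy (q : TM) : R := metric g (tm_vect q) (tm_vect q).

Definition sphere_bundle (r : R) : set TM := [set q | energy q = r ^+ 2].

(* Tangent space at q of the sphere bundle through q: this is a regular level
   set of the energy, so its tangent space is the kernel of the differential. *)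
Definition sphere_tangent c (q : TM) : set TTM :=
  [set U | 'd (energy \o tparam c : TTM -> R) (tcoord c q) U = 0].

(* Orthogonal projection of U on the subspace T, for the metric h. *)
Definition tangential (T : set TTM) (h : TTM -> TTM -> R) (U : TTM) : TTM :=
  xget 0 [set W | T W /\ forall X, T X -> h (U - W) X = 0].

Definition sasaki c (q : TM) (U W : TTM) : R :=
  metric g (hpart c q U) (hpart c q W) + metric g (vpart c q U) (vpart c q W).

Definition J_S c (q : TM) (U : TTM) : TTM :=
  vlift c (hpart c q U) - hlift c (vpart c q U).

(* At a point q of T_r M and on vectors tangent to T_r M, this is phi_r. *)
Definition phi_S c (q : TM) (U : TTM) : TTM :=
  tangential (sphere_tangent c q) (sasaki c q) (J_S c q U).

Section General.
Variables (a b : R -> R) (eps : R).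

Definition metric_A c (q : TM) (U W : TTM) : R :=
  let t := 2^-1 * energy q in
  metric g (hpart c q U) (hpart c q W)
  + a t * metric g (vpart c q U) (vpart c q W)
  + b t * metric g (vpart c q U) (tm_vect q)
    * metric g (vpart c q W) (tm_vect q).

Definition J_A_hor c (q : TM) (X : tangent (tm_base q)) : TTM :=
  let t := 2^-1 * energy q in
  (Num.sqrt (a t))^-1 *: vlift c X
  - ((2 * t)^-1 * ((Num.sqrt (a t))^-1 + eps / Num.sqrt (a t + 2 * b t * t))
     * metric g X (tm_vect q)) *: vlift c (tm_vect q).

Definition J_A_ver c (q : TM) (X : tangent (tm_base q)) : TTM :=
  let t := 2^-1 * energy q in
  - (Num.sqrt (a t) *: hlift c X)
  + ((2 * t)^-1 * (Num.sqrt (a t) + eps * Num.sqrt (a t + 2 * b t * t))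
     * metric g X (tm_vect q)) *: hlift c (tm_vect q).

Definition J_A c (q : TM) (U : TTM) : TTM :=
  J_A_hor c (hpart c q U) + J_A_ver c (vpart c q U).

Definition phi_A c (q : TM) (U : TTM) : TTM :=
  tangential (sphere_tangent c q) (metric_A c q) (J_A c q U).

End General.

(* The map (p, u) |-> (p, r u) on T(M); F is its restriction to T_1 M. *)
Definition Fmap (r : R) (q : TM) : TM := existT _ (tm_base q) (r *: tm_vect q).

Lemma metricZl p (k : R) (X Y : tangent p) :
  metric g (k *: X) Y = k * metric g X Y.
Proof.
have g0 : metric g (0 : tangent p) Y = 0.
  have := metric_linear g 1 0 0 Y; rewrite scaler0 addr0 mul1r.
  by move/eqP; rewrite -subr_eq0 opprD addNKr oppr_eq0 => /eqP.
by have := metric_linear g k X 0 Y; rewrite addr0 g0 addr0.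
Qed.

Lemma Fmap_sphere (r : R) (q : TM) :
  sphere_bundle 1 q -> sphere_bundle r (Fmap r q).
Proof.
rewrite /sphere_bundle/= /energy /Fmap /= => q1.
by rewrite metricZl metric_sym metricZl q1 expr1n mulr1 expr2.
Qed.

(* The differential of F is the restriction of that of Fmap r to the tangent
   spaces of T_1 M; the chart c is used both at q and at Fmap r q. *)
Definition dF (r : R) c (q : TM) (U : TTM) : TTM :=
  'd (tcoord c \o Fmap r \o tparam c : TTM -> TTM) (tcoord c q) U.

(* dF o phi_A = phi_r o dF on the tangent spaces of T_1 M, in any chart *)
Definition is_phi_map (a b : R -> R) (eps r : R) : Prop :=
  forall q c, sphere_bundle 1 q -> chart_dom c (tm_base q) ->
  forall U, sphere_tangent c q U ->
    dF r c q (phi_A a b eps c q U) = phi_S c (Fmap r q) (dF r c q U).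

End TangentBundle.

(* Main.v *)
From HB Require Import structures.
Require Import Defs.
From mathcomp Require Import all_boot all_order all_algebra.
From mathcomp Require Import all_classical all_reals all_analysis.
From mathcomp Require Import ring.
Import Order.TTheory GRing.Theory Num.Theory.
Import numFieldNormedType.Exports.
Local Open Scope ring_scope.

(** Over a point (p, u), a vector tangent to T(M) is determined by its
    horizontal and vertical parts X and V, both tangent to M at p
    ([parts_inj]), and everything is computed in terms of the pair (X, V).

    By compatibility of the Christoffel symbols with the metric, the energy
    has differential (X, V) |-> 2 g(V, u), so the vectors tangent to the sphere
    bundle through (p, u) are those with g(V, u) = 0 ([sphere_tangentP]).  On
    such a vector, discarding the normal component of J_A (X, V) gives
      phi_A (X, V) = (- s V, s^-1 (X - g(X, u) / g(u, u) u)),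
    where s is the square root of a(g(u, u) / 2) ([phi_A_parts]); b and epsilon
    enter only the discarded component.  The Sasaki structure is the member
    a = 1, b = 0, epsilon = -1 of the same family ([phi_SE]), so this formula
    also yields phi_r.  Finally dF (X, V) = (X, r V) ([hpart_dF], [vpart_dF]).

    Hence, with N = X - g(X, u) u at a unit vector u, dF o phi_A sends (X, V)
    to (- s V, (r / s) N) and phi_r o dF sends it to (- r V, N).  These agree
    when r = s.  Conversely, in dimension at least 2 some V != 0 is orthogonal
    to u, and comparing horizontal parts at (0, V) forces r = s. *)

(** * Sums and differentials *)

Lemma exchange_big3 (R : nmodType) (I J K : finType) (F : I -> J -> K -> R) :
  \sum_i \sum_j \sum_k F i j k = \sum_k \sum_i \sum_j F i j k.
Proof.
by rewrite [RHS]exchange_big; apply: eq_bigr => i _; rewrite exchange_big.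
Qed.

Section Differentials.
Context {R : realType} {V W : normedModType R}.

(** Differentials are local: this gives those of maps, read in a chart, that
    have a simple formula only on the image of the chart. *)
Lemma near_eq_is_diff {f h df : V -> W} {x : V} :
  (\forall y \near x, f y = h y) -> is_diff x h df -> is_diff x f df.
Proof.
move=> fh hd; have hdiff : differentiable h x by exact: ex_diff.
have hE : 'd h x = df :> (V -> W) by exact: diff_val.
have fx : f x = h x by exact: nbhs_singleton fh.
have dfc : continuous ('d h x) by exact: diff_continuous.
have fo : f \o shift x = cst (f x) + 'd h x +o_ 0 id.
  apply/eqaddoP => e e0.
  have /eqaddoP/(_ e e0) ho := diff_locally hdiff.
  have fh0 : \forall y \near (0 : V), f (y + x) = h (y + x).
    by move: fh; rewrite (near_shift 0 x) subr0.
  near=> y.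
  have -> : (f \o shift x - (cst (f x) + 'd h x)) y =
            (h \o shift x - (cst (h x) + 'd h x)) y.
    by rewrite !fctE /= fx (near fh0 y).
  by near: y.
have fd := diff_unique dfc fo.
apply: DiffDef; last by rewrite fd.
by apply/diff_locallyP; rewrite fd.
Unshelve. all: by end_near. Qed.

Lemma is_diff_linear (f : V -> W) (x : V) :
  linear f -> continuous f -> is_diff x f f.
Proof.
move=> flin fcont.
pose fM := GRing.isLinear.Build _ _ _ _ _ flin.
pose fL : {linear V -> W} := HB.pack f fM.
apply: DiffDef; first exact: (@linear_differentiable _ _ _ fL).
exact: (@diff_lin _ _ _ fL).
Qed.

Lemma is_diff_sum {I : Type} (s : seq I) {f df : I -> V -> W} {x : V} :
  (forall i, is_diff x (f i) (df i)) ->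
  is_diff x (fun y => \sum_(i <- s) f i y) (fun y => \sum_(i <- s) df i y).
Proof.
move=> fd; elim: s => [|i s ih].
  have -> : (fun y => \sum_(i <- [::]) f i y) = cst 0.
    by apply: funext => y; rewrite big_nil.
  apply: is_diff_eq (is_diff_cst _ _) _.
  by apply: funext => y; rewrite big_nil.
have -> : (fun y => \sum_(j <- i :: s) f j y) =
          f i + (fun y => \sum_(j <- s) f j y).
  by apply: funext => y; rewrite big_cons.
apply: is_diff_eq (is_diffD (fd i) ih) _.
by apply: funext => y; rewrite big_cons.
Qed.

End Differentials.

Section PairDifferentials.
Context {R : realType} {V W : normedModType R}.

Lemma is_diff_fst (z : V * W) : is_diff z fst fst.
Proof. by apply: is_diff_linear => // U; exact: cvg_fst. Qed.

Lemma is_diff_snd (z : V * W) : is_diff z snd snd.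
Proof. by apply: is_diff_linear => // U; exact: cvg_snd. Qed.

End PairDifferentials.

(** * Tangent vectors and metrics in a chart *)

Section Metric.
Context {R : realType} {n : nat} {M : smooth_manifold R n}.

Section Tvec.
Implicit Types (p : M) (c : chart M) (y : 'rV[R]_n).

Lemma tvec_linear c p : linear (@tvec R n M c p).
Proof.
move=> k x y; apply: val_inj; apply: funext => j /=.
rewrite -[RHS]/(k *: tvec_fun c p x j + tvec_fun c p y j) /tvec_fun.
by case: ifP => _; rewrite ?scaler0 ?addr0// /transition linearP.
Qed.

HB.instance Definition _ c p :=
  GRing.isLinear.Build R 'rV[R]_n (tangent p) *:%R (@tvec R n M c p)
    (tvec_linear c p).

Lemma chart_paramK c : {in (chart_coord c @` chart_dom c)%classic,
  cancel (chart_param c) (@chart_coord R n M c)}.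
Proof. by move=> x /set_mem[p pc <-]; rewrite chart_coordK. Qed.

Lemma near_chart_image c p : chart_dom c p ->
  \forall x \near chart_coord c p, (chart_coord c @` chart_dom c)%classic x.
Proof.
by move=> pc; apply: open_nbhs_nbhs; split;
  [exact: chart_image_open | exists p].
Qed.

(** The map [chart_coord c \o chart_param c] is the identity only on the image
    of the chart, which is open. *)
Lemma transition_id c p y : chart_dom c p -> transition c c p y = y.
Proof.
move=> pc; rewrite /transition.
have : is_diff (chart_coord c p) (chart_coord c \o chart_param c) id.
  apply: near_eq_is_diff (is_diff_id _).
  near=> x; rewrite /= chart_paramK// inE.
  by near: x; exact: near_chart_image.
by move=> d; rewrite diff_val.
Unshelve. all: by end_near. Qed.

Lemma component_tvec c p y : chart_dom c p -> component (tvec c p y) c = y.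
Proof. by move=> pc; rewrite /= /tvec_fun asboolT// transition_id. Qed.

Lemma tvec_component c p (X : tangent p) :
  chart_dom c p -> tvec c p (component X c) = X.
Proof.
move=> pc; apply: val_inj; apply: funext => j /=; rewrite /tvec_fun.
have /asboolP[X1 X2] := componentP X.
have [pj|pj] := pselect (chart_dom j p); first by rewrite asboolT// -X1.
by rewrite asboolF ?X2// => -[].
Qed.

Lemma componentD c p (X Y : tangent p) :
  component (X + Y) c = component X c + component Y c.
Proof. by []. Qed.

Lemma componentZ c p k (X : tangent p) :
  component (k *: X) c = k *: component X c.
Proof. by []. Qed.

End Tvec.

Variable g : riemannian_metric M.

Section Bilinear.
Context {p : M}.
Implicit Types X Y Z : tangent p.

Lemma metricDl X Y Z : metric g (X + Y) Z = metric g X Z + metric g Y Z.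
Proof. by rewrite -{1}[X]scale1r metric_linear mul1r. Qed.

Lemma metricDr X Y Z : metric g X (Y + Z) = metric g X Y + metric g X Z.
Proof. by rewrite Defs.metric_sym metricDl !(Defs.metric_sym _ X). Qed.

Lemma metricZr k X Y : metric g X (k *: Y) = k * metric g X Y.
Proof. by rewrite Defs.metric_sym metricZl Defs.metric_sym. Qed.

Lemma metricNl X Y : metric g (- X) Y = - metric g X Y.
Proof. by rewrite -scaleN1r metricZl mulN1r. Qed.

Lemma metric0l X : metric g 0 X = 0.
Proof. by rewrite -(scale0r X) metricZl mul0r. Qed.

Lemma metric_suml (I : Type) (s : seq I) (F : I -> tangent p) Y :
  metric g (\sum_(i <- s) F i) Y = \sum_(i <- s) metric g (F i) Y.
Proof.
by elim/big_rec2 : _ => [|i _ x _ <-]; rewrite ?metric0l// metricDl.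
Qed.

Lemma metric_ge0 X : 0 <= metric g X X.
Proof.
have [->|X0] := eqVneq X 0; first by rewrite metric0l.
by rewrite ltW// metric_pos.
Qed.

Lemma metric_eq0 X : metric g X X = 0 -> X = 0.
Proof.
by move=> gX; apply/eqP/negP => /negP X0; move: (metric_pos g X0);
  rewrite gX ltxx.
Qed.

End Bilinear.

Implicit Types (c : chart M) (x y z : 'rV[R]_n) (q : @TM R n M).

(** No hypothesis on x is needed: off the image of the chart, both sides are
    evaluated at whatever point [chart_param c x] is. *)
Lemma metric_tvec c x y z :
  metric g (tvec c (chart_param c x) y) (tvec c (chart_param c x) z) =
  (y *m gmx g c x *m z^T) 0 0.
Proof.
rewrite -mulmxA mxE [in LHS](row_sum_delta y) linear_sum metric_suml.
apply: eq_bigr => i _; rewrite linearZ metricZl mxE; congr (_ * _).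
rewrite Defs.metric_sym [in LHS](row_sum_delta z) linear_sum metric_suml.
apply: eq_bigr => j _.
by rewrite linearZ metricZl !mxE Defs.metric_sym mulrC.
Qed.

Lemma metric_tvec_at c p y z : chart_dom c p ->
  metric g (tvec c p y) (tvec c p z) =
  (y *m gmx g c (chart_coord c p) *m z^T) 0 0.
Proof. by move=> pc; rewrite -metric_tvec chart_coordK. Qed.

Lemma gmx_unit c p : chart_dom c p -> gmx g c (chart_coord c p) \in unitmx.
Proof.
move=> pc; rewrite -row_free_unit; apply: inj_row_free => v vg.
have := metric_tvec c (chart_coord c p) v v.
rewrite vg mul0mx [in RHS]mxE => /metric_eq0 /(congr1 (fun X => component X c)).
by rewrite component_tvec// chart_coordK.
Qed.

Lemma gmx_sym c x : (gmx g c x)^T = gmx g c x.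
Proof. by apply/matrixP => i j; rewrite !mxE /gcoef Defs.metric_sym. Qed.

Lemma gcoef_diff c p i j :
  chart_dom c p -> differentiable (gcoef g c i j) (chart_coord c p).
Proof. by move=> pc; apply: (metric_smooth g c i j 1).1; exists p. Qed.

Lemma gcoef_sym c i j : gcoef g c i j = gcoef g c j i.
Proof. by apply: funext => x; rewrite /gcoef Defs.metric_sym. Qed.

Lemma diff_gcoefE c p i j (X : 'rV[R]_n) : chart_dom c p ->
  'd (gcoef g c i j) (chart_coord c p) X =
  \sum_k X 0 k * 'D_(delta_mx 0 k) (gcoef g c i j) (chart_coord c p).
Proof.
move=> pc; rewrite [in LHS](row_sum_delta X) linear_sum.
by apply: eq_bigr => k _; rewrite linearZ deriveE//; exact: gcoef_diff.
Qed.

(** Metric compatibility of the connection, on the diagonal: with Gamma the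
    Christoffel form in the direction X, 2 g(Gamma, u) = (d_X g)(u, u). *)
Lemma christoffel_compatible c q (X : 'rV[R]_n) : chart_dom c (tm_base q) ->
  let x := chart_coord c (tm_base q) in let y := component (tm_vect q) c in
  2 * (christoffel_form g c q X *m gmx g c x *m y^T) 0 0 =
  \sum_i \sum_j y 0 i * y 0 j * 'd (gcoef g c i j) x X.
Proof.
move=> qc x y.
pose D i j k := 'D_(delta_mx 0 i) (gcoef g c j k) x.
pose w : 'rV[R]_n := \row_l \sum_i \sum_j
  (D i j l + D j i l - D l i j) * X 0 i * y 0 j.
have -> : christoffel_form g c q X = 2^-1 *: (w *m invmx (gmx g c x)).
  apply/rowP => k; rewrite !mxE mulr_sumr.
  pose T i j l := 2^-1 * ((D i j l + D j i l - D l i j) * X 0 i * y 0 j *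
                          invmx (gmx g c x) l k).
  transitivity (\sum_i \sum_j \sum_l T i j l).
    apply: eq_bigr => i _; apply: eq_bigr => j _.
    rewrite /christoffel mulr_sumr !mulr_suml; apply: eq_bigr => l _.
    by rewrite /T -[in RHS]gmx_sym -trmx_inv mxE -/x -/y /D; ring.
  rewrite exchange_big3; apply: eq_bigr => l _; rewrite mxE mulr_suml mulr_sumr.
  by apply: eq_bigr => i _; rewrite mulr_suml mulr_sumr.
rewrite -scalemxAl mulmxKV ?gmx_unit// -scalemxAl mxE mulrA.
rewrite mulfV ?pnatr_eq0// mul1r.
(* The last two terms of the Christoffel symbol cancel by antisymmetry in
   the two indices that are contracted with u. *)
pose A i j l := D j i l * X 0 i * y 0 j * y 0 l.
transitivity (\sum_i \sum_j \sum_l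
    (D i j l * X 0 i * y 0 j * y 0 l + (A i j l - A i l j))).
  rewrite exchange_big3 mxE; apply: eq_bigr => l _.
  rewrite mxE mulr_suml mxE; apply: eq_bigr => i _; rewrite mulr_suml.
  apply: eq_bigr => j _; rewrite /A /D; ring.
have A0 i : \sum_j \sum_l (A i j l - A i l j) = 0.
  under eq_bigr do rewrite sumrB.
  by rewrite sumrB [X in _ - X]exchange_big subrr.
transitivity (\sum_i \sum_j \sum_l D i j l * X 0 i * y 0 j * y 0 l).
  apply: eq_bigr => i _; under eq_bigr do rewrite big_split.
  by rewrite big_split/= A0 addr0.
rewrite exchange_big; apply: eq_bigr => j _.
rewrite exchange_big; apply: eq_bigr => l _.
rewrite diff_gcoefE// mulr_sumr; apply: eq_bigr => i _.
by rewrite /D -/x; ring.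
Qed.

(** The energy is the quadratic form g_ij(x) y^i y^j in the coordinates (x, y),
    for every x: [tvec] is linear in the components even off the chart. *)
Lemma is_diff_energy c p y : chart_dom c p ->
  is_diff ((chart_coord c p, y) : @TTM R n) (energy g \o tparam c)
  (fun U : TTM =>
    2 * (U.2 *m gmx g c (chart_coord c p) *m y^T) 0 0 +
    \sum_i \sum_j y 0 i * y 0 j * 'd (gcoef g c i j) (chart_coord c p) U.1).
Proof.
move=> pc.
pose co i : @TTM R n -> R := (fun N : 'rV[R]_n => N 0 i) \o snd.
have cod i (z : @TTM R n) : is_diff z (co i) (co i).
  apply: is_diff_linear => [k U1 U2|U]; first by rewrite /co /= !mxE.
  apply: (@continuous_comp _ _ _ snd (fun N : 'rV[R]_n => N 0 i)).
    exact: cvg_snd.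
  exact: coord_continuous.
have -> : energy g \o tparam c =
    fun z : @TTM R n =>
      \sum_i \sum_j ((gcoef g c i j \o fst) * (co i * co j)) z.
  apply: funext => z; rewrite /energy /= metric_tvec mxE exchange_big.
  apply: eq_bigr => j _; rewrite !mxE mulr_suml; apply: eq_bigr => i _.
  by rewrite /co !fctE /= mxE; ring.
have gd i j : is_diff ((chart_coord c p, y) : @TTM R n)
    (gcoef g c i j \o fst) ('d (gcoef g c i j) (chart_coord c p) \o fst).
  have gd0 := differentiableP (gcoef_diff c p i j pc).
  have := @is_diff_comp R (@TTM R n) _ _ fst fst _ _ (chart_coord c p, y)
    (is_diff_fst _) gd0.
  by [].
have sd := is_diff_sum (index_enum 'I_n) (fun i => is_diff_sum (index_enum 'I_n)
  (fun j => is_diffM (gd i j) (is_diffM (cod i _) (cod j _)))).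
apply: is_diff_eq sd _.
apply: funext => U.
transitivity (\sum_i \sum_j (gcoef g c i j (chart_coord c p) *
    (y 0 i * U.2 0 j + y 0 j * U.2 0 i) +
    y 0 i * y 0 j * 'd (gcoef g c i j) (chart_coord c p) U.1)).
  by [].
under eq_bigr do rewrite big_split/=.
rewrite big_split/=; congr (_ + _).
set x := chart_coord c p.
transitivity (\sum_i \sum_j (gcoef g c i j x * (y 0 i * U.2 0 j) +
                             gcoef g c i j x * (y 0 j * U.2 0 i))).
  by apply: eq_bigr => i _; apply: eq_bigr => j _; rewrite mulrDr.
under eq_bigr do rewrite big_split/=.
rewrite big_split/= mulr_natl mulr2n mxE; congr (_ + _).
  apply: eq_bigr => j _; rewrite !mxE mulr_suml; apply: eq_bigr => i _.
  by rewrite mxE gcoef_sym; ring.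
rewrite exchange_big; apply: eq_bigr => j _; rewrite !mxE mulr_suml.
by apply: eq_bigr => i _; rewrite mxE; ring.
Qed.

Lemma sphere_tangentP c q (U : @TTM R n) : chart_dom c (tm_base q) ->
  sphere_tangent g c q U <-> metric g (vpart g c q U) (tm_vect q) = 0.
Proof.
move=> qc.
have dE := is_diff_energy c (tm_base q) (component (tm_vect q) c) qc.
rewrite /sphere_tangent /= diff_val -christoffel_compatible//.
have -> : metric g (vpart g c q U) (tm_vect q) =
    ((U.2 + christoffel_form g c q U.1) *m gmx g c (chart_coord c (tm_base q))
       *m (component (tm_vect q) c)^T) 0 0.
  by rewrite -{1}(tvec_component c _ (tm_vect q))// metric_tvec_at.
rewrite -mulrDr !mulmxDl [X in _ <-> X = _]mxE.
split=> [/eqP|->]; last by rewrite mulr0.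
by rewrite mulf_eq0 pnatr_eq0/= => /eqP.
Qed.

(** * Horizontal and vertical parts *)

Section Parts.
Variables (c : chart M) (q : @TM R n M).
Implicit Types (U W : @TTM R n) (X V : tangent (tm_base q)).

Lemma christoffel_form_linear : linear (christoffel_form g c q).
Proof.
move=> k X Y; apply/rowP => l; rewrite !mxE mulr_sumr -big_split.
apply: eq_bigr => i _; rewrite mulr_sumr -big_split; apply: eq_bigr => j _.
by rewrite !mxE /=; ring.
Qed.

HB.instance Definition _ := GRing.isLinear.Build R 'rV[R]_n 'rV[R]_n *:%R
  (christoffel_form g c q) christoffel_form_linear.

Lemma hpart_linear : linear (hpart c q).
Proof. by move=> k U W; rewrite /hpart /= linearP. Qed.

HB.instance Definition _ := GRing.isLinear.Build R (@TTM R n)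
  (tangent (tm_base q)) *:%R (hpart c q) hpart_linear.

Lemma vpart_linear : linear (vpart g c q).
Proof.
move=> k U W; rewrite /vpart -[RHS]tvec_linear; congr (tvec _ _ _).
by rewrite /= christoffel_form_linear scalerDr addrACA.
Qed.

HB.instance Definition _ := GRing.isLinear.Build R (@TTM R n)
  (tangent (tm_base q)) *:%R (vpart g c q) vpart_linear.

Hypothesis qc : chart_dom c (tm_base q).

Lemma hpart_hlift X : hpart c q (hlift g c X) = X.
Proof. exact: tvec_component. Qed.

Lemma hpart_vlift X : hpart c q (vlift c X) = 0.
Proof. by rewrite /hpart linear0. Qed.

Lemma vpart_hlift X : vpart g c q (hlift g c X) = 0.
Proof. by rewrite /vpart addNr linear0. Qed.

Lemma vpart_vlift X : vpart g c q (vlift c X) = X.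
Proof. by rewrite /vpart /= linear0 addr0 tvec_component. Qed.

Definition liftE := (hpart_hlift, hpart_vlift, vpart_hlift, vpart_vlift).

Lemma parts_inj U W :
  hpart c q U = hpart c q W -> vpart g c q U = vpart g c q W -> U = W.
Proof.
case: U W => [U1 U2] [W1 W2].
move=> /(congr1 (fun X => component X c)) h /(congr1 (fun X => component X c)).
by move: h; rewrite !component_tvec//= => -> /addIr ->.
Qed.

End Parts.

(** * The structure tensors *)

(** Any candidate W for the projection is the one chosen by [tangential], since
    h is definite on T. *)
Lemma tangential_unique (T : set (@TTM R n)) (h : @TTM R n -> @TTM R n -> R)
    (U W : @TTM R n) :
  (forall W1 W2, T W1 -> T W2 -> T (W1 - W2)) ->
  (forall U1 U2 X, h (U1 - U2) X = h U1 X - h U2 X) ->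
  (forall X, T X -> h X X = 0 -> X = 0) ->
  T W -> (forall X, T X -> h (U - W) X = 0) -> tangential T h U = W.
Proof.
move=> TB hB h0 TW hW; apply: xget_unique => // W' [TW' hW'].
apply/eqP; rewrite -subr_eq0; apply/eqP; apply: h0; first exact: TB.
have D : W' - W = (U - W) - (U - W') by rewrite opprB [RHS]addrC subrKA.
by rewrite {1}D hB hW ?hW' ?subrr//; exact: TB.
Qed.

(** The structure tensor at an arbitrary nonzero vector u.  Neither b nor
    epsilon occurs, and no sign condition on b is needed: the terms of the
    metric in b vanish on vectors tangent to the sphere bundle. *)
Lemma phi_A_parts (a b : R -> R) (eps : R) c q (U : @TTM R n) :
  chart_dom c (tm_base q) -> 0 < energy g q -> 0 < a (2^-1 * energy g q) ->
  sphere_tangent g c q U ->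
  let s := Num.sqrt (a (2^-1 * energy g q)) in
  hpart c q (phi_A g a b eps c q U) = - (s *: vpart g c q U) /\
  vpart g c q (phi_A g a b eps c q U) =
    s^-1 *: (hpart c q U -
      (metric g (hpart c q U) (tm_vect q) / energy g q) *: tm_vect q).
Proof.
move=> qc e0 a0 /(sphere_tangentP _ _ _ qc) Ut s.
have s0 : s != 0 by rewrite gt_eqF// sqrtr_gt0.
set X := hpart c q U; set V := vpart g c q U in Ut *.
set u := tm_vect q in Ut *.
set N := X - _.
have Nu : metric g N u = 0.
  by rewrite /N metricDl metricNl metricZl divfK ?gt_eqF// subrr.
suff -> : phi_A g a b eps c q U = hlift g c (- (s *: V)) + vlift c (s^-1 *: N).
  by rewrite !linearD/= !liftE// addr0 add0r.
apply: tangential_unique.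
- move=> W1 W2 /(sphere_tangentP _ _ _ qc) W1t /(sphere_tangentP _ _ _ qc) W2t.
  apply/(sphere_tangentP _ _ _ qc).
  by rewrite linearB metricDl metricNl W1t W2t subrr.
- move=> U1 U2 Y; rewrite /metric_A !linearB/= !metricDl !metricNl; ring.
- move=> Y /(sphere_tangentP _ _ _ qc) Yt; rewrite /metric_A Yt mulr0 addr0.
  move/eqP; rewrite paddr_eq0 ?mulr_ge0 ?metric_ge0 ?(ltW a0)//.
  rewrite mulf_eq0 (gt_eqF a0)/=.
  move=> /andP[/eqP/metric_eq0 hY /eqP/metric_eq0 vY].
  by apply: (parts_inj c q) => //; rewrite linear0.
- apply/(sphere_tangentP _ _ _ qc).
  by rewrite linearD/= !liftE// add0r metricZl Nu mulr0.
move=> Y /(sphere_tangentP _ _ _ qc) Yt.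
set k := (2 * (2^-1 * energy g q))^-1 * (s^-1 + eps / Num.sqrt
  (a (2^-1 * energy g q) + 2 * b (2^-1 * energy g q) * (2^-1 * energy g q))).
(* The normal component of J_A U is vertical, equal to m u. *)
pose m := metric g X u / energy g q / s - k * metric g X u.
have hD : hpart c q (J_A g a b eps c q U -
    (hlift g c (- (s *: V)) + vlift c (s^-1 *: N))) = 0.
  rewrite linearB /J_A /J_A_hor /J_A_ver -/X -/V -/u -/s Ut mulr0 scale0r addr0.
  rewrite !(linearD, linearN, linearZ)/= !liftE//.
  by rewrite !(oppr0, scaler0, scalerN, opprK, subr0, addr0, add0r, addNr)/=.
have vD : vpart g c q (J_A g a b eps c q U -
    (hlift g c (- (s *: V)) + vlift c (s^-1 *: N))) = m *: u.
  rewrite linearB /J_A /J_A_hor /J_A_ver -/X -/V -/u -/s Ut mulr0 scale0r addr0.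
  rewrite !(linearD, linearN, linearZ)/= !liftE//.
  rewrite -/k !(oppr0, scaler0, add0r, addr0, scalerN, scalerA) opprB addrACA.
  by rewrite [_ + - _]addrC addrACA subrr add0r -scalerBl [s^-1 * _]mulrC.
by rewrite /metric_A hD vD Yt metric0l metricZl (Defs.metric_sym _ u) Yt; ring.
Qed.

Lemma sasakiE c q : sasaki g c q = metric_A g (fun=> 1) (fun=> 0) c q.
Proof.
apply: funext => U; apply: funext => W.
by rewrite /sasaki /metric_A mul1r !mul0r addr0.
Qed.

(** With a = 1 and b = 0, epsilon = -1 is the sign for which the terms in
    g(X, u) in the definition of J_A cancel. *)
Lemma phi_SE c q U : phi_S g c q U = phi_A g (fun=> 1) (fun=> 0) (-1) c q U.
Proof.
rewrite /phi_S /phi_A sasakiE; congr tangential.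
rewrite /J_S /J_A /J_A_hor /J_A_ver/=.
rewrite mulr0 mul0r addr0 sqrtr1 invr1 mulN1r subrr mulr0 !mul0r !scale0r.
by rewrite subr0 addr0 !scale1r.
Qed.

Lemma is_diff_Fmap (r : R) c q : chart_dom c (tm_base q) ->
  is_diff (tcoord c q) (tcoord c \o Fmap r \o tparam c)
    (fun U : @TTM R n => (U.1, r *: U.2)).
Proof.
move=> qc.
pose L (U : @TTM R n) : @TTM R n := (U.1, r *: U.2).
have dL : is_diff (tcoord c q) L L.
  exact: is_diff_pair (is_diff_fst _)
    (is_diff_comp (is_diff_snd _) (is_diff_scaler r _)).
apply: near_eq_is_diff dL.
have near_dom : \forall z \near tcoord c q,
    (chart_coord c @` chart_dom c)%classic z.1.
  by apply: (cvg_fst (near_chart_image _ _ qc)).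
near=> z.
have [p pc pz] : (chart_coord c @` chart_dom c)%classic z.1 by near: z.
apply/pair_equal_spec; split; first by rewrite /= -pz chart_coordK.
rewrite -[LHS]/(r *: component (tvec c (chart_param c z.1) z.2) c).
by rewrite component_tvec// -pz chart_coordK.
Unshelve. all: by end_near. Qed.

Lemma dFE (r : R) c q (U : @TTM R n) : chart_dom c (tm_base q) ->
  dF r c q U = (U.1, r *: U.2).
Proof. by move=> qc; have d := is_diff_Fmap r c q qc; rewrite /dF diff_val. Qed.

Lemma hpart_dF (r : R) c q (U : @TTM R n) : chart_dom c (tm_base q) ->
  hpart c (Fmap r q) (dF r c q U) = hpart c q U.
Proof. by move=> qc; rewrite dFE. Qed.

Lemma vpart_dF (r : R) c q (U : @TTM R n) : chart_dom c (tm_base q) ->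
  vpart g c (Fmap r q) (dF r c q U) = r *: vpart g c q U.
Proof.
move=> qc; rewrite dFE// /vpart -[RHS]linearZ; congr (tvec _ _ _).
rewrite /= scalerDr; congr (_ + _); apply/rowP => k; rewrite !mxE mulr_sumr.
apply: eq_bigr => i _; rewrite mulr_sumr; apply: eq_bigr => j _.
by rewrite mxE; ring.
Qed.

Lemma energy_Fmap (r : R) q : energy g (Fmap r q) = r ^+ 2 * energy g q.
Proof. by rewrite /energy /= metricZl metricZr mulrA. Qed.

(** One step of Gram-Schmidt on two coordinate vectors of a chart. *)
Lemma exists_unit_orthogonal : (2 <= n)%N -> inhabited M ->
  exists2 q : @TM R n M, sphere_bundle g 1 q &
  exists2 V : tangent (tm_base q), V != 0 & metric g V (tm_vect q) = 0.
Proof.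
move=> hn [p]; have [c pc] := chart_dom_cover p.
pose e0 := tvec c p (delta_mx 0 (Ordinal (ltnW hn))).
pose e1 := tvec c p (delta_mx 0 (Ordinal hn)).
have e0N0 : e0 != 0.
  apply/eqP => /(congr1 (fun X => component X c)); rewrite component_tvec//.
  by move/rowP/(_ (Ordinal (ltnW hn)))/eqP; rewrite !mxE !eqxx oner_eq0.
pose s := Num.sqrt (metric g e0 e0).
have s2 : s ^+ 2 = metric g e0 e0 by rewrite sqr_sqrtr// metric_ge0.
have s0 : s != 0 by rewrite gt_eqF// sqrtr_gt0 metric_pos.
pose u := s^-1 *: e0.
have uu : metric g u u = 1.
  by rewrite metricZl metricZr -s2; field.
exists (existT _ p u); first by rewrite /sphere_bundle /energy /= uu expr1n.
exists (e1 - metric g e1 u *: u); last first.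
  by rewrite /= metricDl metricNl metricZl uu mulr1 subrr.
apply/eqP => /(congr1 (fun X => component X c)).
rewrite scalerA -scaleNr componentD componentZ !component_tvec//.
by move/rowP/(_ (Ordinal hn))/eqP; rewrite !mxE !eqxx mulr0 addr0 oner_eq0.
Qed.

End Metric.

Theorem theorem3p4 (R : realType) (n : nat) (hn : (2 <= n)%N)
    (M : smooth_manifold R n) (hM : inhabited M) (g : riemannian_metric M)
    (a b : R -> R)
    (a_smooth : smooth_halfline a) (b_smooth : smooth_halfline b)
    (a_pos : forall t, 0 <= t -> 0 < a t)
    (b_ge0 : forall t, 0 <= t -> 0 <= b t)
    (eps : R) (heps : eps = 1 \/ eps = -1)
    (r : R) (hr : 0 < r) :
  is_phi_map g a b eps r <-> r = Num.sqrt (a 2^-1).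
Proof.
have parts q c U : sphere_bundle g 1 q -> chart_dom c (tm_base q) ->
    sphere_tangent g c q U ->
  [/\ hpart c (Fmap r q) (dF r c q (phi_A g a b eps c q U)) =
        - (Num.sqrt (a 2^-1) *: vpart g c q U),
      hpart c (Fmap r q) (phi_S g c (Fmap r q) (dF r c q U)) =
        - (r *: vpart g c q U),
      vpart g c (Fmap r q) (dF r c q (phi_A g a b eps c q U)) =
        (r / Num.sqrt (a 2^-1)) *: (hpart c q U -
          metric g (hpart c q U) (tm_vect q) *: tm_vect q) &
      vpart g c (Fmap r q) (phi_S g c (Fmap r q) (dF r c q U)) =
        hpart c q U - metric g (hpart c q U) (tm_vect q) *: tm_vect q].
  rewrite /sphere_bundle /= expr1n => q1 qc Ut.
  have [|| ] := phi_A_parts g a b eps c q U qc _ _ Ut.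
  - by rewrite q1.
  - by rewrite q1 mulr1 a_pos// invr_ge0.
  rewrite q1 mulr1 divr1 => hA vA.
  have Ut' : sphere_tangent g c (Fmap r q) (dF r c q U).
    apply/sphere_tangentP => //; rewrite vpart_dF// metricZl metricZr.
    by move/sphere_tangentP : Ut => ->//; rewrite !mulr0.
  have [|| ] :=
    phi_A_parts g (fun=> 1) (fun=> 0) (-1) c (Fmap r q) _ qc _ _ Ut'.
  - by rewrite energy_Fmap q1 mulr1 exprn_gt0.
  - by [].
  rewrite -phi_SE hpart_dF// vpart_dF// energy_Fmap q1 mulr1 sqrtr1 invr1.
  rewrite !scale1r => hS vS; rewrite hpart_dF// vpart_dF// hA vA scalerA hS vS.
  split=> //.
  rewrite metricZr scalerA; congr (_ - _ *: _).
  by field; rewrite gt_eqF.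
split=> [F_map|r_eq q c q1 qc U Ut].
  have [q q1 [V V0 Vu]] := exists_unit_orthogonal g hn hM.
  have [c qc] := chart_dom_cover (tm_base q).
  have Vt : sphere_tangent g c q (vlift c V).
    by apply/sphere_tangentP => //; rewrite vpart_vlift.
  have := F_map q c q1 qc _ Vt; have [hA hS _ _] := parts q c _ q1 qc Vt.
  move=> /(congr1 (hpart c (Fmap r q))); rewrite hA hS vpart_vlift//.
  move=> /oppr_inj/eqP; rewrite -subr_eq0 -scalerBl scaler_eq0.
  rewrite (negPf V0) orbF subr_eq0.
  by move/eqP.
have [hA hS vA vS] := parts q c U q1 qc Ut.
apply: (parts_inj g c (Fmap r q)) => //; first by rewrite hA hS r_eq.
by rewrite vA vS -r_eq divff ?scale1r// gt_eqF.
Qed.
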